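(* Let $f:\mathbb{R}^d\to\mathbb{R}$ be differentiable, convex and $L$-smooth ($L>0$), with nonempty set of minimizers; let $x^*$ be a minimizer and $f^*=f(x^* )$. Let $0\le\rho\le\frac1L$ and $x^0\in\mathbb{R}^d$, and let $(x^t)_{t\ge 0}$ be generated by deterministic USAM with constant radius $\rho_t=\rho$ and the Polyak scheduler, i.e. for $t\ge 0$ $$e^t=x^t+\rho\nabla f(x^t),\qquad \gamma_t=\frac{f(e^t)-f^*-\rho\langle\nabla f(e^t),\nabla f(x^t)\rangle}{\|\nabla f(e^t)\|^2},\qquad x^{t+1}=x^t-\gamma_t\nabla f(e^t).$$ Then for all $T\ge 1$, with $\overline{x}^T=\frac1T\sum_{t=0}^{T-1}x^t$, $$f(\overline{x}^T)-f^*\le\frac{2L\|x^0-x^*\|^2}{T(1-L\rho)^2}.$$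
   Context: $\|\cdot\|$ is the Euclidean norm. $f$ is $L$-smooth if $\|\nabla f(x)-\nabla f(y)\|\le L\|x-y\|$ for all $x,y$. Conventions: if $\nabla f(x^t)=0$ then $x^t$ is a minimizer, the algorithm terminates, and we set $x^{s}=x^t$ for all $s\ge t$. In the boundary case $\rho=1/L$ the denominator on the right-hand side is zero and the right-hand side is read as $+\infty$ (the bound is vacuous). *)

(* Defs.v *)
From mathcomp Require Import all_boot all_order all_algebra.
From mathcomp Require Import all_classical all_reals all_analysis.
Import Order.TTheory GRing.Theory Num.Theory.
Import numFieldNormedType.Exports.

Set Implicit Arguments.
Unset Strict Implicit.
Unset Printing Implicit Defensive.

Local Open Scope classical_set_scope.
Local Open Scope ring_scope.

(* The library norm on row vectors is the sup norm, so the Euclidean structure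
   is defined here. The two norms are equivalent, so [differentiable] has its
   usual meaning on R^d. *)
Definition dot (R : realType) (d : nat) (u v : 'rV[R]_d) : R :=
  \sum_(i < d) u 0 i * v 0 i.

Definition enorm (R : realType) (d : nat) (u : 'rV[R]_d) : R :=
  Num.sqrt (dot u u).

Definition grad (R : realType) (d : nat) (f : 'rV[R]_d -> R) (x : 'rV[R]_d) :
    'rV[R]_d :=
  \row_(i < d) 'D_(delta_mx 0 i) f x.

Definition smooth (R : realType) (d : nat) (L : R) (f : 'rV[R]_d -> R) : Prop :=
  forall x y, enorm (grad f x - grad f y) <= L * enorm (x - y).

Definition minimizer (R : realType) (d : nat) (f : 'rV[R]_d -> R)
    (xs : 'rV[R]_d) : Prop :=
  forall y, f xs <= f y.

Definition usam_ascent (R : realType) (d : nat) (f : 'rV[R]_d -> R) (rho : R)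
    (x : 'rV[R]_d) : 'rV[R]_d :=
  x + rho *: grad f x.

Definition polyak_step (R : realType) (d : nat) (f : 'rV[R]_d -> R) (fs rho : R)
    (x : 'rV[R]_d) : R :=
  let e := usam_ascent f rho x in
  (f e - fs - rho * dot (grad f e) (grad f x)) / enorm (grad f e) ^+ 2.

(* The algorithm terminates at a stationary point, where the step-size formula
   would be 0 / 0; the sequence is then continued as a constant. *)
Definition usam_polyak (R : realType) (d : nat) (f : 'rV[R]_d -> R) (fs rho : R)
    (x : nat -> 'rV[R]_d) : Prop :=
  forall t : nat,
    x t.+1 = if grad f (x t) == 0 then x t
             else x t - polyak_step f fs rho (x t)
                          *: grad f (usam_ascent f rho (x t)).

(* Main.v *)
(* Write g = grad f x, e = x + rho g, h = grad f e, D = f x - f^* and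
   N = f e - f^* - rho <h, g>, so that the step is N / |h|^2.
   Convexity gives N <= <h, x - x^*>, hence each step decreases |x - x^*|^2 by
   at least N^2 / |h|^2.  The descent lemma from e to x and |g|^2 <= 2 L D give
   N >= (1 - L^2 rho^2) D, while |h| <= (1 + L rho) |g|.  The factors
   (1 + L rho)^2 cancel: the decrease is at least (1 - L rho)^2 D / (2 L).
   Telescoping and Jensen's inequality conclude. *)
Require Import Defs.
From mathcomp Require Import all_boot all_order all_algebra.
From mathcomp Require Import all_classical all_reals all_analysis.
From mathcomp Require Import ring lra.
Import Order.TTheory GRing.Theory Num.Theory.
Import numFieldNormedType.Exports.

Local Open Scope classical_set_scope.
Local Open Scope ring_scope.

(** * The Euclidean inner product, up to Cauchy-Schwarz and the triangle inequality *)

Section EuclideanStructure.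
Context {R : realType} {d : nat}.
Implicit Types (a : R) (u v w : 'rV[R]_d).

Lemma dotC u v : dot u v = dot v u.
Proof. by apply: eq_bigr => i _; rewrite mulrC. Qed.

Lemma dotDl u v w : dot (u + v) w = dot u w + dot v w.
Proof. by rewrite -big_split; apply: eq_bigr => i _; rewrite mxE mulrDl. Qed.

Lemma dotZl a u v : dot (a *: u) v = a * dot u v.
Proof. by rewrite mulr_sumr; apply: eq_bigr => i _; rewrite mxE mulrA. Qed.

Lemma dotNl u v : dot (- u) v = - dot u v.
Proof. by rewrite -scaleN1r dotZl mulN1r. Qed.

Lemma dotDr u v w : dot u (v + w) = dot u v + dot u w.
Proof. by rewrite dotC dotDl !(dotC u). Qed.

Lemma dotZr a u v : dot u (a *: v) = a * dot u v.
Proof. by rewrite dotC dotZl dotC. Qed.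

Lemma dotNr u v : dot u (- v) = - dot u v.
Proof. by rewrite dotC dotNl dotC. Qed.

Lemma dot0r u : dot u 0 = 0.
Proof. by rewrite -(scale0r 0) dotZr mul0r. Qed.

Lemma dot_sumr (I : Type) (r : seq I) (F : I -> 'rV[R]_d) u :
  dot u (\sum_(i <- r) F i) = \sum_(i <- r) dot u (F i).
Proof.
apply: (big_morph (dot u)); [exact: dotDr|exact: dot0r].
Qed.

Lemma dot_ge0 u : 0 <= dot u u.
Proof. by apply: sumr_ge0 => i _; rewrite -expr2 sqr_ge0. Qed.

Lemma dot_eq0 u : (dot u u == 0) = (u == 0).
Proof.
apply/eqP/eqP => [|->]; last by rewrite dot0r.
move=> /eqP; rewrite psumr_eq0 => [|i _]; last by rewrite -expr2 sqr_ge0.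
move=> /allP u0; apply/rowP => i; rewrite mxE.
by have /= := u0 i (mem_index_enum i); rewrite mulf_eq0 orbb => /eqP.
Qed.

Lemma enorm_ge0 u : 0 <= enorm u.
Proof. exact: sqrtr_ge0. Qed.

Lemma sqr_enorm u : enorm u ^+ 2 = dot u u.
Proof. by rewrite sqr_sqrtr ?dot_ge0. Qed.

Lemma enormZ a u : 0 <= a -> enorm (a *: u) = a * enorm u.
Proof.
by move=> a0; rewrite /enorm dotZl dotZr mulrA sqrtrM ?mulr_ge0// -expr2
  sqrtr_sqr ger0_norm.
Qed.

Lemma cauchy_schwarz u v : dot u v <= enorm u * enorm v.
Proof.
have [/eqP|v0] := eqVneq (dot v v) 0.
  by rewrite dot_eq0 => /eqP ->; rewrite dot0r mulr_ge0 ?enorm_ge0.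
have vv : 0 < dot v v by rewrite lt_def v0 dot_ge0.
apply: (le_trans (ler_norm _)).
rewrite -(@ler_pXn2r _ 2) ?nnegrE ?mulr_ge0 ?enorm_ge0//.
rewrite exprMn !sqr_enorm real_normK ?num_real//.
rewrite -subr_ge0 -(pmulr_rge0 _ vv).
(* This vector is the component of [u] orthogonal to [v], scaled by [dot v v] to avoid a division.
   Its squared norm is [dot v v] times the difference of the two sides. *)
have := dot_ge0 (dot v v *: u - dot u v *: v).
by congr (0 <= _); rewrite !(dotDl, dotDr, dotNl, dotNr, dotZl, dotZr) (dotC v u); ring.
Qed.

Lemma enormD u v : enorm (u + v) <= enorm u + enorm v.
Proof.
rewrite -(@ler_pXn2r _ 2) ?nnegrE ?addr_ge0 ?enorm_ge0//.
rewrite sqrrD !sqr_enorm !(dotDl, dotDr) (dotC v u).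
by have := cauchy_schwarz u v; lra.
Qed.

End EuclideanStructure.

(** * Directional derivatives and first-order convexity *)

Section Gradient.
Context {R : realType} {d : nat} {f : 'rV[R]_d -> R}.
Hypothesis hdiff : forall y, differentiable f y.
Implicit Types (x y v : 'rV[R]_d).

Lemma derive_grad x v : 'D_v f x = dot (grad f x) v.
Proof.
rewrite deriveE// [in LHS](row_sum_delta v) linear_sum.
by apply: eq_bigr => i _; rewrite linearZ /= mxE deriveE// mulrC.
Qed.

(** The difference quotient along the line is that of [f] at [x + t *: v] in direction [v]. *)
Lemma is_derive_line x v (t : R) :
  is_derive t 1 (fun s : R => f (x + s *: v)) (dot (grad f (x + t *: v)) v).
Proof.
have E : (fun h : R => h^-1 *: (((fun s : R => f (x + s *: v)) \o shift t) (h *: (1 : R))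
      - f (x + t *: v)))
   = (fun h : R => h^-1 *: ((f \o shift (x + t *: v)) (h *: v) - f (x + t *: v))).
  apply/funext => h /=; congr (_ *: (f _ - _)).
  by rewrite [h *: 1]mulr1 scalerDl addrCA.
split.
- by rewrite /derivable E; apply: diff_derivable.
- by rewrite -derive_grad /derive E.
Qed.

(** By convexity the difference quotient from [x] towards [y] is at most [f y - f x] for steps [h]
    in (0, 1); let [h] tend to 0 from the right. *)
Lemma convex_gradient_le : convex_function [set: 'rV[R]_d] f ->
  forall x y, f x + dot (grad f x) (y - x) <= f y.
Proof.
move=> hconv x y; rewrite addrC -lerBrDr -derive_grad.
have /cvg_dnbhs_at_right/cvgr_to_le : derivable f x (y - x).
  exact: diff_derivable.
apply; near=> h.
have h0 : 0 < h by near: h; exact: nbhs_right_gt.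
have h1 : h < 1 by near: h; exact: nbhs_right_lt.
have : f (h *: y + (1 - h) *: x) <= h * f y + (1 - h) * f x.
  by apply: (hconv (Itv01 (ltW h0) (ltW h1))); rewrite inE.
have -> : h *: y + (1 - h) *: x = h *: (y - x) + x.
  by rewrite scalerBl scale1r scalerBr addrCA addrC.
move=> hle; change (h^-1 * (f (h *: (y - x) + x) - f x) <= f y - f x).
by rewrite ler_pdivrMl//; lra.
Unshelve. all: by end_near. Qed.

(** Jensen's inequality: sum the tangent inequalities at the mean [m]; the linear terms cancel
    because the deviations [x t - m] sum to 0. *)
Lemma convex_le_mean : convex_function [set: 'rV[R]_d] f ->
  forall (x : nat -> 'rV[R]_d) (T : nat), (0 < T)%N ->
  f (T%:R^-1 *: \sum_(t < T) x t) <= T%:R^-1 * \sum_(t < T) f (x t).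
Proof.
move=> hconv x T T0; set m := _ *: _.
have T0R : 0 < T%:R :> R by rewrite ltr0n.
rewrite ler_pdivlMl//.
have : \sum_(t < T) (f m + dot (grad f m) (x t - m)) <= \sum_(t < T) f (x t).
  by apply: ler_sum => t _; exact: convex_gradient_le.
rewrite big_split /= -dot_sumr sumrB !sumr_const card_ord.
rewrite -[m *+ T]scaler_nat scalerA divff ?gt_eqF// scale1r subrr dot0r addr0.
by rewrite mulr_natl.
Qed.

(** * Consequences of smoothness *)

Context {L : R}.
Hypothesis hL : 0 < L.
Hypothesis hsmooth : smooth L f.

Lemma smooth_descent x y :
  f y <= f x + dot (grad f x) (y - x) + L / 2 * dot (y - x) (y - x).
Proof.
(* The claim is [F 1 <= F 0] for the [F] below. The mean value theorem reduces it to [dF t <= 0],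
   which is Cauchy-Schwarz plus the Lipschitz bound on the gradient. *)
set v := y - x; set c := dot (grad f x) v; set k := L / 2 * dot v v.
pose F (s : R) := f (x + s *: v) - c * s - k * s ^+ 2.
pose dF (s : R) := dot (grad f (x + s *: v)) v - c - k * (2 * s).
have dFP (s : R) : is_derive s 1 F (dF s).
  have Hf := is_derive_line x v s.
  apply: is_derive_eq.
  by rewrite /dF /GRing.scale /=; ring.
have Fcont : {within `[0, 1], continuous F}.
  by apply: derivable_within_continuous => s _; exact: ex_derive.
have [t] := MVT ltr01 (fun s _ => dFP s) Fcont.
rewrite in_itv /= => /andP[t0 t1]; rewrite subr0 mulr1 => FE.
have dF0 : dF t <= 0.
  have : dot (grad f (x + t *: v) - grad f x) v <= L * t * dot v v.
    apply: (le_trans (cauchy_schwarz _ _)).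
    rewrite -sqr_enorm expr2 mulrA ler_wpM2r ?enorm_ge0//.
    apply: (le_trans (hsmooth _ _)).
    by rewrite addrC addKr enormZ ?mulrA// ltW.
  by rewrite /dF dotDl dotNl /c /k; lra.
have F1 : F 1 = f y - c - k.
  by rewrite /F scale1r (addrC x) subrK expr1n !mulr1.
have F0 : F 0 = f x.
  by rewrite /F scale0r addr0 expr0n /= !mulr0 !subr0.
by move: FE; rewrite F1 F0; lra.
Qed.

Context {xs : 'rV[R]_d}.
Hypothesis hmin : minimizer f xs.

(** A gradient step of length [L^-1] lowers [f] by at least |g|^2 / (2 L), but not below [f xs]. *)
Lemma sqr_grad_le_gap x : dot (grad f x) (grad f x) <= 2 * L * (f x - f xs).
Proof.
have := le_trans (hmin _) (smooth_descent x (x - L^-1 *: grad f x)).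
rewrite (addrAC x) subrr add0r !(dotNl, dotNr, dotZl, dotZr).
set q := dot _ _ => H.
have L0 : L != 0 by rewrite gt_eqF.
have : q / (2 * L) <= f x - f xs.
  have -> : q / (2 * L) = L^-1 * q - L / 2 * (L^-1 * (L^-1 * q)) by field.
  by move: H; lra.
by rewrite ler_pdivrMr ?mulr_gt0// mulrC.
Qed.

(** * Analysis of a single step *)

Context {rho : R}.
Hypothesis hrho0 : 0 <= rho.
Hypothesis hrhoL : rho <= 1 / L.

(** The numerator N of the step size. Since x - e = - rho g, it is the linearization of [f] at e,
    evaluated at [x], minus [f xs]. *)
Definition polyak_gap x : R :=
  let e := usam_ascent f rho x in
  f e - f xs - rho * dot (grad f e) (grad f x).

Lemma gap_le_polyak_gap x :
  (1 - (L * rho) ^+ 2) * (f x - f xs) <= polyak_gap x.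
Proof.
have := smooth_descent (usam_ascent f rho x) x.
rewrite /polyak_gap /=; set e := usam_ascent f rho x; set h := grad f e.
have -> : x - e = - (rho *: grad f x) by rewrite /e /usam_ascent opprD addNKr.
rewrite !(dotNl, dotNr, dotZl, dotZr) => H.
(* The descent lemma leaves the error (L / 2) rho^2 |g|^2, which is thus at most (L rho)^2 D. *)
have := ler_wpM2l (mulr_ge0 (ltW hL) (sqr_ge0 rho)) (sqr_grad_le_gap x).
by lra.
Qed.

(** As e - x = rho g, smoothness gives |h - g| <= L rho |g|. *)
Lemma sqr_grad_ascent_le x :
  dot (grad f (usam_ascent f rho x)) (grad f (usam_ascent f rho x))
    <= (1 + L * rho) ^+ 2 * (2 * L * (f x - f xs)).
Proof.
have L1 : 0 <= 1 + L * rho by rewrite addr_ge0// mulr_ge0// ltW.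
apply: (@le_trans _ _ ((1 + L * rho) ^+ 2 * dot (grad f x) (grad f x))); last first.
  by rewrite ler_wpM2l ?sqr_ge0// sqr_grad_le_gap.
rewrite -!sqr_enorm -exprMn ler_pXn2r ?nnegrE ?mulr_ge0 ?enorm_ge0//.
rewrite -[X in grad f X]/(x + rho *: grad f x).
rewrite -[X in enorm X](subrK (grad f x)).
apply: (le_trans (enormD _ _)); rewrite mulrDl mul1r addrC lerD2l.
apply: (le_trans (hsmooth _ _)).
by rewrite addrC addKr enormZ// mulrA.
Qed.

Lemma usam_polyak_step_le (hconv : convex_function [set: 'rV[R]_d] f) x :
  (1 - L * rho) ^+ 2 * (f x - f xs)
    <= 2 * L * (enorm (x - xs) ^+ 2 -
      enorm (x - polyak_step f (f xs) rho x *: grad f (usam_ascent f rho x) - xs)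
        ^+ 2).
Proof.
have Lr0 : 0 <= L * rho by rewrite mulr_ge0// ltW.
have Lr1 : 0 <= 1 - L * rho.
  by rewrite subr_ge0 mulrC -ler_pdivlMr.
have hD : 0 <= f x - f xs by rewrite subr_ge0 hmin.
have := gap_le_polyak_gap x; have := sqr_grad_ascent_le x.
have := convex_gradient_le hconv (usam_ascent f rho x) xs.
rewrite /polyak_step /polyak_gap !sqr_enorm /=.
set e := usam_ascent f rho x; set h := grad f e.
set N := f e - f xs - _; set D := f x - f xs; set r := L * rho in Lr0 Lr1 *.
move=> hle hh hN.
(* The tangent to [f] at [e] lies below [f] at [xs]; the term in [rho] of N moves the base point
   from [e] back to [x]. *)
have hle' : N <= dot h (x - xs).
  have xE : x = e - rho *: grad f x by rewrite addrK.
  rewrite [x in dot h (x - _)]xE.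
  by move: hle; rewrite !(dotDr, dotNr, dotZr) /N; lra.
have N0 : 0 <= N.
  by apply: le_trans hN; rewrite mulr_ge0//; nra.
have [h0|h0] := eqVneq (dot h h) 0.
  have hE : h = 0 by apply/eqP; rewrite -dot_eq0 h0.
  (* Here [h = 0] makes the step vanish ([N / 0 = 0]), but it also forces
     [N <= 0], so that the left-hand side is nonpositive. *)
  rewrite hE scaler0 subr0 subrr mulr0.
  have NN : N <= 0 by move: hle'; rewrite hE dotC dot0r.
  have : (1 - r) * D <= 0.
    have r1 : 0 < 1 + r by lra.
    by rewrite -(pmulr_rle0 _ r1); move: hN NN; lra.
  by move=> ?; rewrite expr2 -mulrA mulr_ge0_le0.
have hpos : 0 < dot h h by rewrite lt_def h0 dot_ge0.
have -> : x - (N / dot h h) *: h - xs = (x - xs) - (N / dot h h) *: h.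
  by rewrite addrAC.
move: (x - xs) hle' => w hle'.
rewrite !(dotDl, dotDr, dotNl, dotNr, dotZl, dotZr) (dotC w h).
rewrite [leRHS](_ : _ = 2 * L * ((2 * N * dot h w - N ^+ 2) / dot h h));
  last by field.
rewrite mulrA ler_pdivlMr//.
(* Hence 2 N <h, w> - N^2 >= N^2, where [w] stands for [x - xs]. *)
have NN : N * N <= N * dot h w by rewrite ler_wpM2l.
have hN2 : ((1 - r ^+ 2) * D) ^+ 2 <= N ^+ 2.
  by rewrite ler_pXn2r ?nnegrE// mulr_ge0//; nra.
(* The weight (1 - r)^2 D completes (1 + r)^2 to (1 - r^2)^2, so that the bound on |h|^2 meets
   [hN2]. *)
have hh2 := ler_wpM2l (mulr_ge0 (sqr_ge0 (1 - r)) hD) hh.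
apply: (le_trans hh2).
have -> : (1 - r) ^+ 2 * D * ((1 + r) ^+ 2 * (2 * L * D))
    = 2 * L * ((1 - r ^+ 2) * D) ^+ 2 by ring.
rewrite ler_wpM2l ?mulr_ge0 ?(ltW hL)//.
by apply: (le_trans hN2); lra.
Qed.

End Gradient.

Theorem theorem3p2 (R : realType) (d : nat) (f : 'rV[R]_d -> R) (L rho : R)
    (xs : 'rV[R]_d) (x : nat -> 'rV[R]_d)
    (hdiff : forall y, differentiable f y)
    (hconv : convex_function [set: 'rV[R]_d] f)
    (hL : 0 < L)
    (hsmooth : smooth L f)
    (hmin : minimizer f xs)
    (hrho0 : 0 <= rho)
    (hrhoL : rho <= 1 / L)
    (hx : usam_polyak f (f xs) rho x)
    (T : nat) (hT : (1 <= T)%N) :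
  let xbar : 'rV[R]_d := T%:R^-1 *: \sum_(t < T) x t in
  ((f xbar - f xs)%:E <=
     if (rho == 1 / L)%R then +oo
     else (2 * L * enorm (x 0%N - xs) ^+ 2 / (T%:R * (1 - L * rho) ^+ 2))%:E)%E.
Proof.
cbv zeta; set xbar := _ *: _; case: ifPn => [_|rhoNL]; first by rewrite leey.
rewrite lee_fin.
have Lrho : 0 < 1 - L * rho.
  by rewrite subr_gt0 mulrC -ltr_pdivlMr// lt_def eq_sym rhoNL.
have T0 : 0 < T%:R :> R by rewrite ltr0n.
have step t : (1 - L * rho) ^+ 2 * (f (x t) - f xs)
    <= 2 * L * (enorm (x t - xs) ^+ 2 - enorm (x t.+1 - xs) ^+ 2).
  (* After termination the distance no longer changes, and the tangent inequality at the stationary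
     point shows that its gap is nonpositive. *)
  rewrite hx; case: eqP => [g0|_]; last exact: usam_polyak_step_le.
  rewrite subrr mulr0 mulr_ge0_le0 ?sqr_ge0// subr_le0.
  by have := convex_gradient_le hdiff hconv (x t) xs; rewrite g0 dotC dot0r addr0.
have sum_le : (1 - L * rho) ^+ 2 * \sum_(t < T) (f (x t) - f xs)
    <= 2 * L * enorm (x 0%N - xs) ^+ 2.
  (* The induction needs the telescoped form, which keeps the final distance; that term is then
     dropped. *)
  apply: (@le_trans _ _
    (2 * L * (enorm (x 0%N - xs) ^+ 2 - enorm (x T - xs) ^+ 2))); last first.
    by rewrite ler_wpM2l ?mulr_ge0 ?(ltW hL)// lerBlDr lerDl sqr_ge0.
  elim: {hT T0 xbar} T => [|T IH]; first by rewrite big_ord0 subrr !mulr0.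
  by rewrite big_ord_recr /= mulrDr; have := step T; lra.
rewrite ler_pdivlMr ?mulr_gt0 ?exprn_gt0//.
apply: le_trans sum_le; rewrite mulrA mulrC ler_wpM2l ?sqr_ge0//.
rewrite sumrB sumr_const card_ord -[f xs *+ T]mulr_natr mulrBl lerD2r.
have := convex_le_mean hdiff hconv x T hT.
by rewrite ler_pdivlMl// mulrC.
Qed.
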